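(* Let $X_1,\ldots,X_n\in\mathbb{R}^p$ be independent random vectors with $\mathbb{E}[X_i]=0$, and suppose that for every deterministic $v\in\mathbb{R}^p$ with $\|v\|=1$ we have $\mathbb{E}|X_i^\top v|^k\le b_L(k;X_i)$, where $b_L(k;X_i)$ is a deterministic quantity depending only on $k$ and on the distribution of $X_i$. Let $R_1,\dots,R_n$ be deterministic real numbers, let $$\mathcal{S}=\frac1n\sum_{i=1}^n R_i^2X_iX_i^\top ,$$ let $A$ be a deterministic positive definite $p\times p$ matrix with $A\succeq t\,\mathrm{Id}_p$ for some $t>0$, and set $M=\mathcal{S}+A$. For a deterministic $x\in\mathbb{R}^p$ with $\|x\|=1$ let $f(X)=x^\top M^{-1}x$. Then for every $k\ge 2$ there is a constant $c_k$, depending only on $k$, such that $$\mathbb{E}\left|f(X)-\mathbb{E}f(X)\right|^k\le \frac{c_k}{t^{2k}}\left[\left(\sum_{i=1}^n\left[\frac{R_i^4}{n^2}b_L(4;X_i)\wedge t^2\right]\right)^{k/2}+\sum_{i=1}^n\left[\frac{R_i^{2k}}{n^k}b_L(2k;X_i)\wedge t^k\right]\right].$$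
   Context: $a\wedge b=\min(a,b)$; $\|\cdot\|$ is the Euclidean norm; $\succeq$ is the Loewner order on symmetric matrices. The moment bounds $b_L(\cdot\,;X_i)$ are assumed finite for the exponents that appear. *)

(* Defs.v *)
From HB Require Import structures.
From mathcomp Require Export all_boot all_order all_algebra.
From mathcomp Require Export all_classical all_reals all_analysis.

Set Implicit Arguments.
Unset Strict Implicit.
Unset Printing Implicit Defensive.

Import Order.TTheory GRing.Theory Num.Theory.
Import numFieldNormedType.Exports.

Local Open Scope classical_set_scope.
Local Open Scope ring_scope.

Section LinearAlgebra.
Variables (R : realType) (p : nat).
Implicit Types (u v x : 'cV[R]_p) (A B : 'M[R]_p).

Definition dotv u v : R := (u^T *m v) 0 0.

(* The library norm [`|v|] on matrices is the sup norm, hence this one. *)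
Definition enorm v : R := Num.sqrt (\sum_(j < p) v j 0 ^+ 2).

Definition qform A v : R := (v^T *m A *m v) 0 0.

Definition posdefmx A : Prop :=
  A^T = A /\ forall v, v != 0 -> 0 < qform A v.

Definition possemidefmx A : Prop :=
  A^T = A /\ forall v, 0 <= qform A v.

Definition loewner_ge A B : Prop := possemidefmx (A - B).

Definition weighted_cov n (r : 'I_n -> R) (X : 'I_n -> 'cV[R]_p) : 'M[R]_p :=
  n%:R^-1 *: \sum_(i < n) (r i ^+ 2) *: (X i *m (X i)^T).

End LinearAlgebra.

(* Random vectors take values in [p.-tuple R], which carries the product Borel
   sigma-algebra; matrices have no measurable structure in the library. *)
Definition vec (R : realType) (p : nat) (x : p.-tuple R) : 'cV[R]_p :=
  \col_(j < p) tnth x j.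

Definition mutually_independent (d d' : measure_display)
    (T : measurableType d) (T' : measurableType d') (R : realType)
    (P : probability T R) (n : nat) (X : 'I_n -> {RV P >-> T'}) : Prop :=
  forall (J : {set 'I_n}) (B : 'I_n -> set T'),
    (forall i, measurable (B i)) ->
    P (\bigcap_(i in [set i | i \in J]) (X i @^-1` B i)) =
    (\prod_(i in J) P (X i @^-1` B i))%E.

(* Main.v *)
Require Import Defs.
From mathcomp Require Import ring lra.

(** Removing the [j]-th observation changes [f] by a rank one perturbation of
    the inverted matrix, so, writing [M_j] for [M] without its [j]-th term and
    [s_j] for [r_j^2 / n],
      [0 <= x^T M_j^-1 x - x^T M^-1 x <= min (s_j * (X_j . M_j^-1 x)^2) (1 / t)]
    ([rank_one_update_bounds]).  The vector [M_j^-1 x] has length at most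
    [1 / t] and does not involve [X_j], so averaging over [X_j] alone bounds
    the [q]-th moment of the change by
    [t^-2q * min (s_j^q * b_L (2q; X_j)) (t^q)], whatever the other
    observations are ([leave_one_out_moment_le]).

    It remains to control the fluctuation of a bounded function [F] of
    independent variables by such leave-one-out differences
    ([moment_le_leave_one_out]).  Let [G_j] be the mean of [F] over all
    variables but the first [j]; it goes from the constant [E F] at [j = 0] to
    [F] at [j = n], with martingale increments [d_j = G_(j+1) - G_j].  As a
    function that ignores coordinate [j] can be subtracted from [F] at the cost
    of a constant factor, the conditional moments of [d_j] of orders [2] and
    [k] are at most constant multiples of deterministic numbers [v_j] and
    [m_j].  Expanding [|S + d|^k] around [S = G_j - E F]
    ([powR_norm_add_le]) and taking conditional means removes the linear term;
    because the bounds [v_j] and [m_j] are deterministic, this leaves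
      [E |G_(j+1) - E F|^k
         <= E |G_j - E F|^k + C * (v_j * E |G_j - E F|^(k-2) + m_j)].
    With [V] the sum of the [v_j], a pointwise Young inequality bounds
    [V * |S|^(k-2)] by [eta * |S|^k + C_eta * V^(k/2)], and the resulting linear
    recurrence is solved by [linear_recurrence_le].

    Independence enters through a single identity, [mean_resample]: the mean of
    a function of all the variables does not change when one of them is replaced
    by an independent copy.  Conditional means are then plain integrals over
    the replaced coordinate, and exchanging them is Fubini's theorem; since
    [0 <= f <= 1 / t], every function involved is bounded. *)

Set Implicit Arguments.
Unset Strict Implicit.
Unset Printing Implicit Defensive.

Import Order.TTheory GRing.Theory Num.Theory.
Import numFieldNormedType.Exports.

Local Open Scope classical_set_scope.
Local Open Scope ring_scope.

(** * Inequalities between real powers *)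

Section RealInequalities.
Variable R : realType.
Implicit Types (a b d k q s u v x y V eta : R).

(** This is [expR (- y) >= 1 - y] inverted, since
    [(1 + y + 2 y^2) (1 - y) = 1 + y^2 (1 - 2 y) >= 1]. *)
Lemma expR_le_quadratic y : y <= 1 / 2 -> expR y <= 1 + y + 2 * y ^+ 2.
Proof.
move=> hy.
have e0 := expR_gt0 (- y).
have e1 : expR y * expR (- y) = 1 by rewrite expRxMexpNx_1.
have e2 := expR_ge1Dx (- y).
have hq : 0 <= y ^+ 2 by exact: sqr_ge0.
have h : 1 <= (1 + y + 2 * y ^+ 2) * (1 - y).
  have -> : (1 + y + 2 * y ^+ 2) * (1 - y) = 1 + y ^+ 2 * (1 - 2 * y) by ring.
  by rewrite lerDl mulr_ge0//; lra.
have hp : 0 <= 1 + y + 2 * y ^+ 2.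
  have -> : 1 + y + 2 * y ^+ 2 = 2 * (y + 1/4) ^+ 2 + 7 / 8 by field.
  by have := sqr_ge0 (y + 1/4); lra.
rewrite -(ler_pM2r e0) e1 (le_trans h)// ler_wpM2l//; lra.
Qed.

(** If [2 k |u| <= 1], then [(1 + u)^k <= exp (k u)] is at most quadratic in
    [k u].  Otherwise [1 + |u| <= (2 k + 1) |u|], so the last term alone is
    enough, and the other three have a nonnegative sum. *)
Lemma powR_norm1D_le k u : 2 <= k ->
  `|1 + u| `^ k <=
  1 + k * u + 2 * k ^+ 2 * u ^+ 2 + (2 * k + 1) `^ k * `|u| `^ k.
Proof.
move=> hk.
have k0 : 0 <= k by lra.
have hpos : 0 <= (2 * k + 1) `^ k * `|u| `^ k by rewrite mulr_ge0 ?powR_ge0.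
have [hu|hu] := lerP (2 * k * `|u|) 1.
  have := ler_norm u; have := ler_normr u (- u); rewrite opprK lexx orbT => hu1 hu2.
  have {}hu1 : - `|u| <= u by have := lerNnormlW (lexx `|u|).
  have hu3 : `|u| <= 1 by have : 0 <= `|u| by []; nra.
  have h1u : 0 <= 1 + u by lra.
  rewrite ger0_norm//.
  have h1 : (1 + u) `^ k <= expR (k * u).
    rewrite mulrC expRM; apply: ge0_ler_powR; rewrite ?nnegrE ?expR_ge0//.
    exact: expR_ge1Dx.
  have h2 : k * u <= 1 / 2 by nra.
  have := expR_le_quadratic h2.
  rewrite exprMn mulrA; lra.
have h1 : `|1 + u| <= (2 * k + 1) * `|u|.
  by rewrite (le_trans (ler_normD _ _))// normr1; lra.
have h2 : `|1 + u| `^ k <= (2 * k + 1) `^ k * `|u| `^ k.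
  rewrite -powRM; [|lra|by []].
  by apply: ge0_ler_powR => //; rewrite nnegrE// mulr_ge0//; lra.
have h3 : 0 <= 1 + k * u + 2 * k ^+ 2 * u ^+ 2.
  have -> : 1 + k * u + 2 * k ^+ 2 * u ^+ 2 =
     (1 + k * u / 2) ^+ 2 + 7 / 4 * (k * u) ^+ 2 by field.
  by have := sqr_ge0 (1 + k * u / 2); have := sqr_ge0 (k * u); lra.
lra.
Qed.

Lemma powR_normM_sqr k s : 2 <= k -> `|s| `^ k = `|s| `^ (k - 2) * s ^+ 2.
Proof.
move=> hk; have [->|s0] := eqVneq s 0.
  rewrite normr0 powR0; last by rewrite gt_eqF//; lra.
  by rewrite expr0n/= mulr0.
rewrite -{1}(subrK 2 k) [LHS]powRD; last by rewrite normr_eq0 s0 implybT.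
by rewrite (@powR_mulrn _ _ 2)// real_normK// num_real.
Qed.

(** The second-order expansion of [|s + d|^k] around [s], obtained by scaling
    [powR_norm1D_le]; the linear term is kept exactly because it is going to
    have mean zero. *)
Lemma powR_norm_add_le k s d : 2 <= k ->
  `|s + d| `^ k <= `|s| `^ k + k * (`|s| `^ (k - 2) * s) * d +
    (2 * k ^+ 2 + (2 * k + 1) `^ k) * (`|s| `^ (k - 2) * d ^+ 2 + `|d| `^ k).
Proof.
move=> hk.
have hp : 1 <= (2 * k + 1) `^ k.
  rewrite -[leLHS](_ : 1 `^ k = 1); last by rewrite powR1.
  by apply: ge0_ler_powR; rewrite ?nnegrE; lra.
have hd : 0 <= `|d| `^ k by exact: powR_ge0.
have hk2 : 0 <= k ^+ 2 := sqr_ge0 k.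
have hsd : 0 <= `|s| `^ (k - 2) * d ^+ 2 by rewrite mulr_ge0 ?powR_ge0 ?sqr_ge0.
have [->|s0] := eqVneq s 0.
  rewrite add0r !mulr0 mul0r addr0 normr0 (@powR0 _ k); last by rewrite gt_eqF//; lra.
  have hq : 0 <= (0 : R) `^ (k - 2) * d ^+ 2 by rewrite mulr_ge0 ?powR_ge0 ?sqr_ge0.
  rewrite add0r -[leLHS]mul1r ler_pM ?ler01 ?lerDr//; lra.
have s0' : 0 < `|s| by rewrite normr_gt0.
have -> : s + d = s * (1 + d / s) by rewrite mulrDr mulr1 mulrCA divff// mulr1.
rewrite normrM powRM//.
have := @powR_norm1D_le k (d / s) hk.
rewrite -(ler_pM2l (powR_gt0 k s0')) => /le_trans; apply.
rewrite !mulrDr mulr1 (mulrA _ _ (_ / s)).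
have -> : `|s| `^ k * ((2 * k + 1) `^ k * `|d / s| `^ k) = (2 * k + 1) `^ k * `|d| `^ k.
  rewrite mulrCA; congr (_ * _); rewrite -powRM// -normrM; congr (`| _ | `^ _).
  by rewrite mulrCA divff ?mulr1.
have -> : `|s| `^ k * (2 * k ^+ 2 * (d / s) ^+ 2) =
    2 * k ^+ 2 * (`|s| `^ (k - 2) * d ^+ 2).
  by rewrite powR_normM_sqr//; field.
have -> : `|s| `^ k * k * (d / s) = k * (`|s| `^ (k - 2) * s) * d.
  by rewrite powR_normM_sqr//; field.
nra.
Qed.

(** Either [V <= eta s^2], and the first term on the right dominates, or
    [s^2 < V / eta], and the second one does. *)
Lemma young_powR_sqr k V eta s : 2 <= k -> 0 <= V -> 0 < eta ->
  V * `|s| `^ (k - 2) <=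
  eta * `|s| `^ k + eta^-1 `^ ((k - 2) / 2) * V `^ (k / 2).
Proof.
move=> hk V0 e0.
have h0 : 0 <= eta^-1 `^ ((k - 2) / 2) * V `^ (k / 2) by rewrite mulr_ge0 ?powR_ge0.
have h1 : 0 <= eta * `|s| `^ k by rewrite mulr_ge0 ?powR_ge0 ?ltW.
have [hV|hV] := lerP V (eta * s ^+ 2).
  apply: (@le_trans _ _ (eta * `|s| `^ k)); last lra.
  by rewrite (@powR_normM_sqr k s)// [_ `^ _ * s ^+ 2]mulrC mulrA ler_wpM2r ?powR_ge0.
apply: (@le_trans _ _ (eta^-1 `^ ((k - 2) / 2) * V `^ (k / 2))); last lra.
have V1 : 0 < V by rewrite (le_lt_trans _ hV)// mulr_ge0 ?sqr_ge0// ltW.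
have -> : k / 2 = 1 + (k - 2) / 2 by field.
rewrite [V `^ _]powRD ?(gt_eqF V1) ?implybT// powRr1// mulrCA ler_pM2l//.
rewrite -powRM// ?invr_ge0 ?(ltW e0)//.
set e := (k - 2) / 2; have e1 : 0 <= e by rewrite /e; lra.
have -> : k - 2 = 2 * e by rewrite /e; field.
rewrite powRrM (@powR_mulrn _ _ 2)// real_normK ?num_real//.
apply: ge0_ler_powR; rewrite ?nnegrE ?sqr_ge0//.
  by rewrite mulr_ge0 ?invr_ge0 ?ltW.
by rewrite ler_pdivlMl// ltW.
Qed.

(** Convexity of the power function, deduced from Young's inequality for the
    conjugate exponents [q] and [q / (q - 1)]. *)
Lemma powR_tangent_le q c x : 1 <= q -> 0 <= c -> 0 <= x ->
  c `^ q + q * c `^ (q - 1) * (x - c) <= x `^ q.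
Proof.
move=> q1 c0 x0; have q0 : 0 < q by lra.
have hc : c * c `^ (q - 1) = c `^ q by rewrite mulr_powRB1.
have -> : c `^ q + q * c `^ (q - 1) * (x - c) = q * (x * c `^ (q - 1)) - (q - 1) * c `^ q.
  by rewrite -hc; ring.
have [->|qn1] := eqVneq q 1.
  by rewrite subrr mul0r subr0 powRr0 mul1r mulr1 powRr1.
have q1' : 0 < q - 1 by rewrite subr_gt0 lt_neqAle eq_sym qn1.
have := @conjugate_powR _ x (c `^ (q - 1)) q (q / (q - 1)) x0 (powR_ge0 _ _) q0
   (divr_gt0 q0 q1').
have -> : q^-1 + (q / (q - 1))^-1 = 1 by field; lra.
move=> /(_ erefl); rewrite -powRrM.
have -> : (q - 1) * (q / (q - 1)) = q by field; lra.
rewrite -(ler_pM2l q0) => /le_trans h; rewrite lerBlDr; apply: h.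
rewrite mulrDr mulrCA divff ?gt_eqF// mulr1 lerD2l.
by rewrite le_eqVlt; apply/orP; left; apply/eqP; field; lra.
Qed.

Lemma powR_norm_sub_le q a b : 0 <= q ->
  `|a - b| `^ q <= 2 `^ q * (`|a| `^ q + `|b| `^ q).
Proof.
move=> q0.
wlog hab : a b / `|a| <= `|b|.
  move=> W; have [/W//|/ltW/W] := lerP `|a| `|b|.
  by rewrite distrC [X in _ -> _ <= _ * X]addrC.
apply: (@le_trans _ _ ((2 * `|b|) `^ q)).
  apply: ge0_ler_powR; rewrite ?nnegrE//.
  by rewrite (le_trans (ler_normB _ _))//; lra.
rewrite powRM// ler_wpM2l ?powR_ge0// lerDr powR_ge0//.
Qed.

(** By induction [a j] is at most the partial sum of the [b i + theta i * B],
    with [B] the sum of all [b i]; since the [theta i] add up to at most [1],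
    this stays below [2 B], which is what the factor [1 + theta j / 2] needs. *)
Lemma linear_recurrence_le n (a : nat -> R) (theta b : 'I_n -> R) :
  a 0%N = 0 -> (forall j, 0 <= theta j) -> (forall j, 0 <= b j) ->
  \sum_j theta j <= 1 ->
  (forall j : 'I_n, a j.+1 <= (1 + theta j / 2) * a j + b j) ->
  a n <= 2 * \sum_j b j.
Proof.
move=> a0 t0 b0 t1 ha; set B := \sum_j b j.
have B0 : 0 <= B by apply: sumr_ge0.
have sub (c : 'I_n -> R) j : (forall i, 0 <= c i) ->
    \sum_(i < n | (i < j)%N) c i <= \sum_i c i.
  by move=> c0; rewrite [leRHS](bigID (fun i : 'I_n => (i < j)%N))/= lerDl sumr_ge0.
have rec (c : 'I_n -> R) j (jn : (j < n)%N) :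
    \sum_(i < n | (i < j.+1)%N) c i = c (Ordinal jn) + \sum_(i < n | (i < j)%N) c i.
  rewrite (bigD1 (Ordinal jn))//=; congr (_ + _); apply: eq_bigl => i.
  by rewrite ltnS -val_eqE/= andbC -ltn_neqAle.
have H j : (j <= n)%N -> a j <= \sum_(i < n | (i < j)%N) b i +
    B * \sum_(i < n | (i < j)%N) theta i.
  elim: j => [_|j IH jn]; first by rewrite a0 !big_pred0// mulr0 addr0.
  have h1 := IH (ltnW jn).
  have h2 : a j <= 2 * B.
    have := sub _ j b0; have := sub _ j t0.
    by rewrite -/B => h3 h4; nra.
  rewrite !rec; have := ha (Ordinal jn); have := t0 (Ordinal jn).
  by move=> /= h3 h4; nra.
apply: le_trans (H n (leqnn n)) _.
have := sub _ n b0; have := sub _ n t0; rewrite -/B; nra.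
Qed.

End RealInequalities.

(** * Means of bounded measurable functions *)

Definition bounded_measurable d (T : measurableType d) (R : realType)
    (g : T -> R) : Prop :=
  measurable_fun [set: T] g /\ exists B, forall x, `|g x| <= B.

Section BoundedMeasurable.
Context d (T : measurableType d) (R : realType).
Implicit Types (f g : T -> R).

Lemma bounded_measurable_cst (c : R) : bounded_measurable (fun _ : T => c).
Proof. by split; [exact: measurable_cst|exists `|c|]. Qed.

Lemma bounded_measurableD f g : bounded_measurable f -> bounded_measurable g ->
  bounded_measurable (fun x => f x + g x).
Proof.
move=> [mf [A fA]] [mg [B gB]]; split; first exact: measurable_realfun.measurable_funD.
by exists (A + B) => x; rewrite (le_trans (ler_normD _ _))// lerD.
Qed.

Lemma bounded_measurableM f g : bounded_measurable f -> bounded_measurable g ->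
  bounded_measurable (fun x => f x * g x).
Proof.
move=> [mf [A fA]] [mg [B gB]]; split; first exact: measurable_realfun.measurable_funM.
by exists (A * B) => x; rewrite normrM ler_pM.
Qed.

Lemma bounded_measurableN f : bounded_measurable f ->
  bounded_measurable (fun x => - f x).
Proof.
move=> [mf [A fA]]; split; first exact: measurable_realfun.measurable_funN.
by exists A => x; rewrite normrN.
Qed.

Lemma bounded_measurableB f g : bounded_measurable f -> bounded_measurable g ->
  bounded_measurable (fun x => f x - g x).
Proof. by move=> bf bg; apply: bounded_measurableD => //; exact: bounded_measurableN. Qed.

Lemma bounded_measurable_powR_norm q f : 0 <= q -> bounded_measurable f ->
  bounded_measurable (fun x => `|f x| `^ q).
Proof.
move=> q0 [mf [A fA]]; split.
  apply: (measurableT_comp (measurable_realfun.measurable_powR q)).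
  exact: measurableT_comp.
exists (A `^ q) => x; rewrite ger0_norm ?powR_ge0//.
by apply: ge0_ler_powR; rewrite ?nnegrE// (le_trans _ (fA x)).
Qed.

End BoundedMeasurable.

Lemma bounded_measurable_comp d d' (T : measurableType d) (T' : measurableType d')
    (R : realType) (h : T' -> R) (phi : T -> T') :
  measurable_fun [set: T] phi -> bounded_measurable h ->
  bounded_measurable (fun x => h (phi x)).
Proof.
move=> mphi [mh [B hB]]; split; first exact: measurableT_comp.
by exists B.
Qed.

(** The elementary properties of integrals below are stated for bounded
    measurable functions, for which no integrability condition is left. *)
Section Expectation.
Context d (T : measurableType d) (R : realType) (P : probability T R).
Implicit Types (f g : T -> R).

Lemma bounded_measurable_integrable g : bounded_measurable g ->
  P.-integrable [set: T] (EFin \o g).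
Proof.
move=> [mg [B gB]]; apply: measurable_bounded_integrable => //.
  by rewrite (le_lt_trans (probability_le1 _ _))// ltry.
exists B; split; first exact: num_real.
by move=> M BM x _; rewrite /= (le_trans (gB x))// ltW.
Qed.

Local Notation bm := bounded_measurable.
Let bmi := bounded_measurable_integrable.

Lemma EFin_Rintegral g : bm g -> (\int[P]_x g x)%:E = (\int[P]_x (g x)%:E)%E.
Proof. by move=> bg; rewrite fineK//; exact: (integrable_fin_num _ (bmi bg)). Qed.

Lemma mean_cst (c : R) : \int[P]_x c = c.
Proof.
rewrite Rintegral_cst// -[RHS]mulr1; congr (_ * _).
exact: (congr1 fine (probability_setT P)).
Qed.

Lemma meanD f g : bm f -> bm g ->
  \int[P]_x (f x + g x) = \int[P]_x f x + \int[P]_x g x.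
Proof. by move=> bf bg; rewrite RintegralD//; exact: bmi. Qed.

Lemma meanB f g : bm f -> bm g ->
  \int[P]_x (f x - g x) = \int[P]_x f x - \int[P]_x g x.
Proof. by move=> bf bg; rewrite RintegralB//; exact: bmi. Qed.

Lemma meanZ c g : bm g -> \int[P]_x (c * g x) = c * \int[P]_x g x.
Proof. by move=> bg; rewrite RintegralZl//; exact: bmi. Qed.

Lemma le_mean f g : bm f -> bm g -> (forall x, f x <= g x) ->
  \int[P]_x f x <= \int[P]_x g x.
Proof. by move=> bf bg fg; apply: le_Rintegral => //; exact: bmi. Qed.

Lemma norm_mean_le g B : bm g -> (forall x, `|g x| <= B) -> `|\int[P]_x g x| <= B.
Proof.
move=> bg gB; rewrite (le_trans (le_normr_Rintegral _ (bmi bg)))//.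
rewrite -[leRHS]mean_cst; apply: le_mean => //; last exact: bounded_measurable_cst.
case: bg => mg _; split; first exact: measurableT_comp.
by exists B => x; rewrite normr_id.
Qed.

(** Integrate the tangent line inequality at the mean. *)
Lemma jensen_powR_norm q g : 1 <= q -> bm g ->
  `|\int[P]_x g x| `^ q <= \int[P]_x `|g x| `^ q.
Proof.
move=> q1 bg; set c := `|_|.
have q0 : 0 <= q by lra.
have bn : bm (fun x => `|g x|).
  case: bg => mg [B gB]; split; first exact: measurableT_comp.
  by exists B => x; rewrite normr_id.
have cle : c <= \int[P]_x `|g x| by exact: le_normr_Rintegral (bmi bg).
have -> : c `^ q = c `^ q + q * c `^ (q - 1) * (c - c) by rewrite subrr mulr0 addr0.
apply: (@le_trans _ _ (c `^ q + q * c `^ (q - 1) * (\int[P]_x `|g x| - c))).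
  by rewrite lerD2l ler_wpM2l ?mulr_ge0 ?powR_ge0// lerD2r.
rewrite -[X in _ * (_ - X)]mean_cst -meanB//; last exact: bounded_measurable_cst.
have b1 : bm (fun x => `|g x| - c).
  by apply: bounded_measurableB => //; exact: bounded_measurable_cst.
have b2 : bm (fun x => q * c `^ (q - 1) * (`|g x| - c)).
  by apply: bounded_measurableM => //; exact: bounded_measurable_cst.
rewrite -meanZ// -[X in X + _]mean_cst -meanD//; last exact: bounded_measurable_cst.
apply: le_mean => [||x].
- by apply: bounded_measurableD => //; exact: bounded_measurable_cst.
- exact: bounded_measurable_powR_norm.
- by apply: powR_tangent_le; rewrite // /c.
Qed.

(** The mean is, up to a constant factor, as good a centring as any other: the
    distance from it to [c] is controlled by Jensen's inequality. *)
Lemma centred_moment_le q g (c : R) : 1 <= q -> bm g ->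
  \int[P]_x `|g x - \int[P]_y g y| `^ q <=
  2 `^ (q + 1) * \int[P]_x `|g x - c| `^ q.
Proof.
move=> q1 bg; have q0 : 0 <= q by lra.
have bh : bm (fun x => g x - c).
  by apply: bounded_measurableB => //; exact: bounded_measurable_cst.
set m := \int[P]_y g y.
have mc : m - c = \int[P]_x (g x - c).
  by rewrite meanB ?mean_cst//; exact: bounded_measurable_cst.
have bhq := bounded_measurable_powR_norm q0 bh.
have J : `|m - c| `^ q <= \int[P]_x `|g x - c| `^ q.
  by rewrite mc; exact: jensen_powR_norm.
have bs : bm (fun x => `|g x - c| `^ q + `|m - c| `^ q).
  by apply: bounded_measurableD => //; exact: bounded_measurable_cst.
apply: (@le_trans _ _ (\int[P]_x (2 `^ q * (`|g x - c| `^ q + `|m - c| `^ q)))).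
  apply: le_mean => [||x].
  - apply: bounded_measurable_powR_norm => //; apply: bounded_measurableB => //.
    exact: bounded_measurable_cst.
  - by apply: bounded_measurableM => //; exact: bounded_measurable_cst.
  - have -> : g x - m = (g x - c) - (m - c) by ring.
    exact: powR_norm_sub_le.
rewrite meanZ// meanD//; last exact: bounded_measurable_cst.
have -> : 2 `^ (q + 1) = 2 `^ q * 2 :> R.
  by rewrite powRD ?powRr1// pnatr_eq0 implybT.
rewrite mean_cst -mulrA ler_wpM2l ?powR_ge0//.
by rewrite mulrDl mul1r lerD2l.
Qed.

(** One martingale step: [s] is the current value of the martingale and [g] its
    next increment, whose zero mean removes the linear term of the
    expansion. *)
Lemma conditional_step k s g v m : 2 <= k -> bm g -> \int[P]_x g x = 0 ->
  \int[P]_x (`|g x| `^ 2) <= v -> \int[P]_x (`|g x| `^ k) <= m ->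
  \int[P]_x (`|s + g x| `^ k) <= `|s| `^ k +
    (2 * k ^+ 2 + (2 * k + 1) `^ k) * (`|s| `^ (k - 2) * v + m).
Proof.
move=> hk bg g0 gv gm; have k0 : 0 <= k by lra.
set C := 2 * k ^+ 2 + _.
have C0 : 0 <= C by rewrite addr_ge0 ?powR_ge0// mulr_ge0 ?sqr_ge0.
set a := `|s| `^ (k - 2); have a0 : 0 <= a by exact: powR_ge0.
have b2 := bounded_measurable_powR_norm (ler0n R 2) bg.
have bk := bounded_measurable_powR_norm k0 bg.
have bc c := @bounded_measurable_cst _ T R c.
have h1 : bm (fun x => k * (a * s) * g x) by apply: bounded_measurableM.
have h2 : bm (fun x => a * `|g x| `^ 2) by apply: bounded_measurableM.
have h3 : bm (fun x => a * `|g x| `^ 2 + `|g x| `^ k) by apply: bounded_measurableD.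
have h4 : bm (fun x => C * (a * `|g x| `^ 2 + `|g x| `^ k)) by apply: bounded_measurableM.
have h5 : bm (fun x => `|s| `^ k + k * (a * s) * g x) by apply: bounded_measurableD.
apply: (@le_trans _ _ (\int[P]_x (`|s| `^ k + k * (a * s) * g x +
    C * (a * `|g x| `^ 2 + `|g x| `^ k)))).
  apply: le_mean => [||x].
  - by apply: bounded_measurable_powR_norm => //; exact: bounded_measurableD.
  - exact: bounded_measurableD.
  - rewrite (@powR_mulrn _ _ 2)// real_normK ?num_real//.
    exact: powR_norm_add_le.
rewrite meanD// meanD// mean_cst meanZ// g0 mulr0 addr0 lerD2l meanZ// ler_wpM2l//.
by rewrite meanD// meanZ// lerD// ler_wpM2l.
Qed.

End Expectation.

Section BoundedFubini.
Context d1 d2 (T1 : measurableType d1) (T2 : measurableType d2) (R : realType)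
  (P1 : probability T1 R) (P2 : probability T2 R).
Variable (h : T1 * T2 -> R).
Hypothesis bh : bounded_measurable h.

Let ih : (P1 \x P2)%E.-integrable [set: T1 * T2] (EFin \o h).
Proof.
exact: (bounded_measurable_integrable (P1 \x P2)%E bh).
Qed.

Lemma bounded_measurable_section x : bounded_measurable (fun y => h (x, y)).
Proof. exact: (bounded_measurable_comp (measurable_pair1 x) bh). Qed.

Lemma bounded_measurable_section2 y : bounded_measurable (fun x => h (x, y)).
Proof. exact: (bounded_measurable_comp (measurable_pair2 y) bh). Qed.

Lemma bounded_measurable_mean : bounded_measurable (fun x => \int[P2]_y h (x, y)).
Proof.
split; last first.
  case: bh => _ [B hB]; exists B => x.
  by apply: norm_mean_le => //; exact: bounded_measurable_section.
have := measurable_fubini_F ih.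
rewrite /fubini_F => mF; apply/measurable_realfun.measurable_EFinP.
apply: eq_measurable_fun mF => x _ /=.
by rewrite -EFin_Rintegral//; exact: bounded_measurable_section.
Qed.

Lemma bounded_measurable_mean2 : bounded_measurable (fun y => \int[P1]_x h (x, y)).
Proof.
split; last first.
  case: bh => _ [B hB]; exists B => x.
  by apply: norm_mean_le => //; exact: bounded_measurable_section2.
have := measurable_fubini_G ih.
rewrite /fubini_G => mG; apply/measurable_realfun.measurable_EFinP.
apply: eq_measurable_fun mG => x _ /=.
by rewrite -EFin_Rintegral//; exact: bounded_measurable_section2.
Qed.

Lemma mean_swap :
  \int[P1]_x \int[P2]_y h (x, y) = \int[P2]_y \int[P1]_x h (x, y).
Proof.
apply: EFin_inj.
rewrite (EFin_Rintegral _ bounded_measurable_mean).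
rewrite (EFin_Rintegral _ bounded_measurable_mean2).
under eq_integral => x _.
  rewrite EFin_Rintegral; last exact: bounded_measurable_section.
  over.
under [RHS]eq_integral => x _.
  rewrite EFin_Rintegral; last exact: bounded_measurable_section2.
  over.
exact: (Fubini ih).
Qed.

End BoundedFubini.

(** * Resampling one of several independent variables *)

Section Tuples.
Context dE (E : measurableType dE) (n : nat).

Definition box (B : 'I_n -> set E) : set (n.-tuple E) :=
  [set y | forall i, B i (tnth y i)].

Definition update (y : n.-tuple E) (j : 'I_n) (z : E) : n.-tuple E :=
  [tuple if i == j then z else tnth y i | i < n].

Definition splice (j : nat) (y y' : n.-tuple E) : n.-tuple E :=
  [tuple if (i < j)%N then tnth y i else tnth y' i | i < n].

Lemma measurable_update d (S : measurableType d) (f : S -> n.-tuple E)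
    (g : S -> E) j :
  measurable_fun [set: S] f -> measurable_fun [set: S] g ->
  measurable_fun [set: S] (fun s => update (f s) j (g s)).
Proof.
move=> /measurable_fun_tnthP mf mg; apply/measurable_fun_tnthP => i.
have [->|ij] := eqVneq i j.
  rewrite (_ : _ \o _ = g)//; apply/funext => s /=.
  by rewrite tnth_mktuple eqxx.
rewrite (_ : _ \o _ = (@tnth _ _ ^~ i \o f)); first exact: mf.
by apply/funext => s /=; rewrite tnth_mktuple (negbTE ij).
Qed.

Lemma measurable_splice d (S : measurableType d) (f g : S -> n.-tuple E) j :
  measurable_fun [set: S] f -> measurable_fun [set: S] g ->
  measurable_fun [set: S] (fun s => splice j (f s) (g s)).
Proof.
move=> /measurable_fun_tnthP mf /measurable_fun_tnthP mg.
apply/measurable_fun_tnthP => i; have [ij|ij] := boolP (i < j)%N.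
  rewrite (_ : _ \o _ = (@tnth _ _ ^~ i \o f)); first exact: mf.
  by apply/funext => s /=; rewrite tnth_mktuple ij.
rewrite (_ : _ \o _ = (@tnth _ _ ^~ i \o g)); first exact: mg.
by apply/funext => s /=; rewrite tnth_mktuple (negbTE ij).
Qed.

Lemma splice_all y y' : splice n y y' = y.
Proof. by apply: eq_from_tnth => i; rewrite tnth_mktuple ltn_ord. Qed.

Lemma splice0 y y' : splice 0 y y' = y'.
Proof. by apply: eq_from_tnth => i; rewrite tnth_mktuple. Qed.

Lemma spliceS_update (j : 'I_n) y y' z :
  splice j.+1 (update y j z) y' = splice j y (update y' j z).
Proof.
apply: eq_from_tnth => i; rewrite !tnth_mktuple ltnS leq_eqVlt.
have [->|ij] := eqVneq i j; first by rewrite eqxx ltnn.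
by rewrite -val_eqE in ij; rewrite (negbTE ij).
Qed.

Lemma spliceS_update_out (j : 'I_n) y y' z :
  splice j.+1 (update y j z) y' = update (splice j.+1 y y') j z.
Proof.
apply: eq_from_tnth => i; rewrite !tnth_mktuple.
by have [->|//] := eqVneq i j; rewrite ltnS leqnn.
Qed.

(** Boxes form a pi-system that generates the product sigma-algebra, so a
    probability on tuples is determined by its values on boxes. *)
Lemma measurable_tuple_box :
  @measurable _ (n.-tuple E) =
  <<s [set A | exists2 B, (forall i, measurable (B i)) & A = box B] >>.
Proof.
apply/seteqP; split.
  apply: smallest_sub; first exact: smallest_sigma_algebra.
  move=> A; rewrite -bigcup_seq => -[i _] [C mC <-].
  apply: sub_sigma_algebra; exists (fun k => if k == i then C else setT).
    by move=> k; case: ifP.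
  rewrite setTI; apply/seteqP; split => y /=.
    by move=> Cy k; case: eqVneq => [->|].
  by move=> /(_ i); rewrite eqxx.
apply: smallest_sub; first exact: sigma_algebra_measurable.
move=> _ [B mB ->].
rewrite (_ : box B = \bigcap_(i in [set: 'I_n]) ((@tnth _ _ ^~ i) @^-1` B i)).
  apply: fin_bigcap_measurable; first exact: finite_finset.
  by move=> i _; rewrite -[X in measurable X]setTI; exact: measurable_tnth.
by apply/seteqP; split => y /=; [move=> By i _|move=> By i]; exact: By.
Qed.

Lemma setI_closed_box :
  setI_closed [set A | exists2 B, (forall i, measurable (B i)) & A = box B].
Proof.
move=> _ _ [B mB ->] [C mC ->]; exists (fun i => B i `&` C i).
  by move=> i; exact: measurableI.
apply/seteqP; split => y /=; first by move=> [By Cy] i; split; [exact: By|exact: Cy].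
by move=> BC; split => i; have [] := BC i.
Qed.

Lemma eq_mean_tuple d1 d2 (S1 : measurableType d1) (S2 : measurableType d2)
    (R : realType) (P1 : probability S1 R) (P2 : probability S2 R)
    (f1 : S1 -> n.-tuple E) (f2 : S2 -> n.-tuple E) (h : n.-tuple E -> R) :
  measurable_fun [set: S1] f1 -> measurable_fun [set: S2] f2 ->
  (forall B, (forall i, measurable (B i)) ->
    P1 (f1 @^-1` box B) = P2 (f2 @^-1` box B)) ->
  bounded_measurable h ->
  \int[P1]_s h (f1 s) = \int[P2]_s h (f2 s).
Proof.
move=> mf1 mf2 fB bh; congr fine.
have i1 : f1 \in mfun by rewrite inE.
have i2 : f2 \in mfun by rewrite inE.
pose g1 : {mfun S1 >-> n.-tuple E} := mfun_Sub i1.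
pose g2 : {mfun S2 >-> n.-tuple E} := mfun_Sub i2.
have mh := (measurable_realfun.measurable_EFinP _ _).2 bh.1.
have e1 := @integral_distribution _ _ _ _ _ P1 g1 _ mh
  (bounded_measurable_integrable P1 (bounded_measurable_comp mf1 bh)).
have e2 := @integral_distribution _ _ _ _ _ P2 g2 _ mh
  (bounded_measurable_integrable P2 (bounded_measurable_comp mf2 bh)).
transitivity (\int[distribution P1 g1]_y (h y)%:E)%E; first by rewrite e1.
transitivity (\int[distribution P2 g2]_y (h y)%:E)%E; last by rewrite e2.
apply: eq_measure_integral => A mA _.
apply: (measure_unique _ (fun=> setT) measurable_tuple_box setI_closed_box) => //.
- by move=> _; exists (fun=> setT) => //; apply/seteqP; split.
- exact: bigcup_const.
- by move=> _ [B mB ->]; exact: fB.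
- by move=> _; rewrite (le_lt_trans (probability_le1 _ _))// ltry.
Qed.

End Tuples.

Section Resampling.
Context d (T : measurableType d) (R : realType) (P : probability T R)
  dE (E : measurableType dE) (n : nat) (X : 'I_n -> {RV P >-> E}).
Hypothesis hindep : mutually_independent X.

Definition joint (w : T) : n.-tuple E := [tuple X i w | i < n].

Lemma measurable_joint : measurable_fun [set: T] joint.
Proof.
apply/measurable_fun_tnthP => i; rewrite (_ : _ \o _ = X i)//.
by apply/funext => w /=; rewrite tnth_mktuple.
Qed.

(** The left-hand side is an integral against the law of [joint], the right-hand
    side one against the law of the tuple whose [j]-th entry comes from an
    independent copy of the probability space.  On a box both laws give the
    product of the marginal probabilities. *)
Lemma mean_resample (h : n.-tuple E -> R) (j : 'I_n) : bounded_measurable h ->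
  \int[P]_w h (joint w) =
  \int[P]_w \int[P]_w' h (update (joint w) j (X j w')).
Proof.
move=> bh.
pose phi (u : T * T) := update (joint u.1) j (X j u.2).
have mphi : measurable_fun [set: T * T] phi.
  apply: measurable_update; first exact: measurableT_comp measurable_joint _.
  exact: measurableT_comp.
have bphi := bounded_measurable_comp mphi bh.
transitivity (\int[(P \x P)%E]_u h (phi u)).
  apply: eq_mean_tuple => //; first exact: measurable_joint.
  move=> B mB.
  have e1 : joint @^-1` box B =
    \bigcap_(i in [set i | i \in [set: 'I_n]%SET]) (X i @^-1` B i).
    apply/seteqP; split => w /=.
      by move=> By i _; have := By i; rewrite tnth_mktuple.
    by move=> By i; rewrite tnth_mktuple; apply: By; rewrite /= inE.
  have e2 : phi @^-1` box B =
    (\bigcap_(i in [set i | i \in [set~ j]%SET]) (X i @^-1` B i)) `*` (X j @^-1` B j).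
    apply/seteqP; split => -[w w'] /=.
      move=> By; split.
        move=> i /=; rewrite !inE => ij; have := By i.
        by rewrite !tnth_mktuple (negbTE ij).
      by have := By j; rewrite tnth_mktuple eqxx.
    move=> [By Bj] i; rewrite !tnth_mktuple; case: eqVneq => [->//|ij].
    by apply: By; rewrite /= !inE.
  have mX i : measurable (X i @^-1` B i).
    by rewrite -[X in measurable X]setTI; exact: measurable_funP.
  rewrite e1 e2 [RHS]product_measure1E//; last first.
    by apply: fin_bigcap_measurable; [exact: finite_finset|move=> i _; exact: mX].
  apply: (etrans (hindep _ mB)); rewrite (bigD1 j)/= ?inE// muleC.
  congr (_ * _)%E; apply: (etrans _ (esym (hindep _ mB))).
  by apply: eq_bigl => i; rewrite !inE.
rewrite /Rintegral.
rewrite -(integral12_prod_meas1 (bounded_measurable_integrable (P \x P)%E bphi)).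
congr fine; apply: eq_integral => w _; rewrite EFin_Rintegral//.
exact: bounded_measurable_section bphi w.
Qed.

End Resampling.

(** * Moments of functions of independent variables *)

Section Martingale.
Context d (T : measurableType d) (R : realType) (P : probability T R)
  dE (E : measurableType dE) (n : nat) (X : 'I_n -> {RV P >-> E}).
Hypothesis hindep : mutually_independent X.
Variable F : n.-tuple E -> R.
Hypothesis bF : bounded_measurable F.

(** The conditional mean of [F] given the first [j] variables, as a function of
    the values of these variables. *)
Definition partial_mean (j : nat) (y : n.-tuple E) : R :=
  \int[P]_w F (splice j y (joint X w)).

Lemma partial_mean_all y : partial_mean n y = F y.
Proof.
rewrite /partial_mean (_ : (fun w => _) = fun=> F y) ?mean_cst//.
by apply/funext => w; rewrite splice_all.
Qed.

Lemma partial_mean0 y : partial_mean 0 y = \int[P]_w F (joint X w).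
Proof.
by rewrite /partial_mean; congr Rintegral; apply/funext => w; rewrite splice0.
Qed.

Lemma bounded_measurable_partial_mean j : bounded_measurable (partial_mean j).
Proof.
have jm : joint X \in mfun by rewrite inE; exact: measurable_joint.
apply: (@bounded_measurable_mean _ _ _ T R (distribution P (mfun_Sub jm)) P
  (fun u => F (splice j u.1 (joint X u.2)))).
apply: bounded_measurable_comp bF; apply: measurable_splice => //.
exact: measurableT_comp (@measurable_joint _ _ _ _ _ _ _ X) _.
Qed.

Lemma measurable_update_RV (y : n.-tuple E) j :
  measurable_fun [set: T] (fun w => update y j (X j w)).
Proof. by apply: measurable_update => //; exact: measurable_cst. Qed.

Lemma measurable_update_joint (j : 'I_n) :
  measurable_fun [set: T * T] (fun u => update (joint X u.1) j (X j u.2)).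
Proof.
apply: measurable_update; last exact: measurableT_comp.
exact: measurableT_comp (@measurable_joint _ _ _ _ _ _ _ X) _.
Qed.

Lemma measurable_splice_update (j : 'I_n) y :
  measurable_fun [set: T * T] (fun u => update (splice j.+1 y (joint X u.2)) j (X j u.1)).
Proof.
apply: measurable_update; last exact: measurableT_comp.
apply: measurable_splice; first exact: measurable_cst.
exact: measurableT_comp (@measurable_joint _ _ _ _ _ _ _ X) _.
Qed.

(** The martingale property: averaging over coordinate [j] turns the mean over
    the coordinates after [j] into the mean over those from [j] on. *)
Lemma partial_mean_step (j : 'I_n) y :
  \int[P]_w partial_mean j.+1 (update y j (X j w)) = partial_mean j y.
Proof.
pose h u := F (splice j y (update (joint X u.2) j (X j u.1))).
have bh : bounded_measurable h.
  apply: bounded_measurable_comp bF; apply: measurable_splice.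
    exact: measurable_cst.
  apply: measurable_update; last exact: measurableT_comp.
  exact: measurableT_comp (@measurable_joint _ _ _ _ _ _ _ X) _.
transitivity (\int[P]_w' \int[P]_w h (w', w)).
  congr Rintegral; apply/funext => w'; congr Rintegral; apply/funext => w.
  by rewrite spliceS_update.
rewrite mean_swap// /h/=.
rewrite -(@mean_resample _ _ _ _ _ _ _ X hindep (fun y' => F (splice j y y')))//.
apply: bounded_measurable_comp bF; apply: measurable_splice => //.
Qed.

(** The increment is [partial_mean F j.+1] centred at its own mean over
    coordinate [j].  Centring instead at the corresponding partial mean of
    [Fj], which ignores that coordinate, costs a constant factor and leaves a
    partial mean of [F - Fj]; Jensen's inequality and Fubini's theorem reduce
    its moments to those of [F - Fj]. *)
Lemma increment_moment_le q (j : 'I_n) (Fj : n.-tuple E -> R) m y : 1 <= q ->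
  bounded_measurable Fj -> (forall y z, Fj (update y j z) = Fj y) ->
  (forall y, \int[P]_w (`|F (update y j (X j w)) - Fj y| `^ q) <= m) ->
  \int[P]_w (`|partial_mean j.+1 (update y j (X j w)) - partial_mean j y| `^ q)
    <= 2 `^ (q + 1) * m.
Proof.
move=> q1 bFj Fj_update hm; have q0 : 0 <= q by lra.
pose H := \int[P]_w Fj (splice j.+1 y (joint X w)).
have bg : bounded_measurable (fun w => partial_mean j.+1 (update y j (X j w))).
  apply: bounded_measurable_comp (bounded_measurable_partial_mean _).
  exact: measurable_update_RV.
rewrite -(partial_mean_step j y).
apply: le_trans (centred_moment_le P H q1 bg) _; rewrite ler_wpM2l ?powR_ge0//.
pose D y' := F y' - Fj y'.
have bD : bounded_measurable D by exact: bounded_measurableB.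
pose h (u : T * T) := D (update (splice j.+1 y (joint X u.2)) j (X j u.1)).
have bh : bounded_measurable h.
  exact: bounded_measurable_comp (measurable_splice_update j y) bD.
have bhq := bounded_measurable_powR_norm q0 bh.
have ms (y' : n.-tuple E) : measurable_fun [set: T] (fun w => splice j.+1 y' (joint X w)).
  apply: measurable_splice; first exact: measurable_cst.
  exact: measurable_joint.
apply: (@le_trans _ _ (\int[P]_w' \int[P]_w (`|h (w', w)| `^ q))).
  apply: le_mean => [||w'].
  - apply: bounded_measurable_powR_norm => //.
    by apply: bounded_measurableB => //; exact: bounded_measurable_cst.
  - exact: (bounded_measurable_mean P P bhq).
  - rewrite /partial_mean /H -meanB//; last 2 first.
    + exact: bounded_measurable_comp (ms _) bF.
    + exact: bounded_measurable_comp (ms _) bFj.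
    rewrite (_ : (fun w => _) = fun w => h (w', w)).
      by apply: jensen_powR_norm => //; exact: bounded_measurable_section bh w'.
    by apply/funext => w; rewrite /h /D/= Fj_update spliceS_update_out.
rewrite (mean_swap P P bhq) -[leRHS](mean_cst P); apply: le_mean => [||w].
- exact: (bounded_measurable_mean2 P P bhq).
- exact: bounded_measurable_cst.
- rewrite (_ : (fun w' => _) = fun w' =>
    `|F (update (splice j.+1 y (joint X w)) j (X j w')) -
      Fj (splice j.+1 y (joint X w))| `^ q)//.
  by apply/funext => w'; rewrite /h /D/= Fj_update.
Qed.

End Martingale.

(** A Rosenthal-type inequality for functions of independent variables: [F_ j]
    is any approximation of [F] that does not depend on coordinate [j], and
    [v j], [m j] bound the moments of the error when only that coordinate is
    random, uniformly in the other ones. *)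
Lemma moment_le_leave_one_out (R : realType) (k : R) : 2 <= k ->
  exists2 C : R, 0 <= C &
  forall d (T : measurableType d) (P : probability T R)
    dE (E : measurableType dE) (n : nat) (X : 'I_n -> {RV P >-> E})
    (F : n.-tuple E -> R) (F_ : 'I_n -> n.-tuple E -> R) (v m : 'I_n -> R),
  mutually_independent X ->
  bounded_measurable F -> (forall j, bounded_measurable (F_ j)) ->
  (forall j y z, F_ j (update y j z) = F_ j y) ->
  (forall j, 0 <= v j) -> (forall j, 0 <= m j) ->
  (forall j y, \int[P]_w (`|F (update y j (X j w)) - F_ j y| `^ 2) <= v j) ->
  (forall j y, \int[P]_w (`|F (update y j (X j w)) - F_ j y| `^ k) <= m j) ->
  \int[P]_w (`|F (joint X w) - \int[P]_w' F (joint X w')| `^ k) <=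
  C * ((\sum_j v j) `^ (k / 2) + \sum_j m j).
Proof.
move=> hk; have k0 : 0 <= k by lra.
have k1 : 1 <= k by lra.
pose C0 := 2 * k ^+ 2 + (2 * k + 1) `^ k.
have C0_gt0 : 0 < C0.
  by rewrite ltr_wpDl ?powR_gt0 ?mulr_ge0 ?sqr_ge0//; lra.
(* With this [eta] Young's inequality gives the factor [1 + theta j / 2]. *)
pose eta := (2 * C0)^-1.
have eta_gt0 : 0 < eta by rewrite invr_gt0 mulr_gt0.
pose K := eta^-1 `^ ((k - 2) / 2).
have K0 : 0 <= K by exact: powR_ge0.
pose c2 : R := 2 `^ (2 + 1); pose ck : R := 2 `^ (k + 1).
have c20 : 0 <= c2 by exact: powR_ge0.
have ck0 : 0 <= ck by exact: powR_ge0.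
exists (2 * (C0 * K * c2 `^ (k / 2) + C0 * ck)).
  by rewrite mulr_ge0// addr_ge0// !mulr_ge0 ?powR_ge0// ltW.
move=> d T P dE E n X F F_ v m hindep bF bF_ F_update v0 m0 hv hm.
pose G := partial_mean X F; pose mu := \int[P]_w F (joint X w).
have bG j : bounded_measurable (G j) by exact: bounded_measurable_partial_mean.
have bGmu j : bounded_measurable (fun y => `|G j y - mu| `^ k).
  apply: bounded_measurable_powR_norm => //; apply: bounded_measurableB => //.
  exact: bounded_measurable_cst.
pose a j := \int[P]_w (`|G j (joint X w) - mu| `^ k).
have -> : \int[P]_w (`|F (joint X w) - mu| `^ k) = a n.
  by congr Rintegral; apply/funext => w; rewrite /G partial_mean_all.
pose V := \sum_j c2 * v j.
have V0 : 0 <= V by rewrite sumr_ge0// => j _; rewrite mulr_ge0.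
(* If [V = 0], then all [v j] and [theta j] vanish, as [0^-1 = 0]. *)
pose theta j := c2 * v j / V.
have t0 j : 0 <= theta j by rewrite divr_ge0 ?mulr_ge0.
have thetaV j : theta j * V = c2 * v j.
  have [V00|Vn0] := eqVneq V 0; last by rewrite divfK.
  rewrite V00 mulr0; apply/esym.
  by apply: (psumr_eq0P (fun j _ => mulr_ge0 c20 (v0 j)) V00).
have theta1 : \sum_j theta j <= 1.
  rewrite -mulr_suml -/V; have [->|Vn0] := eqVneq V 0; first by rewrite mul0r.
  by rewrite divff.
pose b j := theta j * (C0 * K * V `^ (k / 2)) + C0 * (ck * m j).
have b0 j : 0 <= b j.
  by rewrite addr_ge0 ?(mulr_ge0 (t0 j)) ?mulr_ge0 ?powR_ge0 ?(ltW C0_gt0).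
have a0 : a 0%N = 0.
  rewrite /a (_ : (fun w => _) = fun=> 0) ?mean_cst//.
  apply/funext => w; rewrite /G partial_mean0 subrr normr0 powR0// gt_eqF//; lra.
have step (j : 'I_n) : a j.+1 <= (1 + theta j / 2) * a j + b j.
  (* The step is proved with all coordinates but the [j]-th frozen at [y]. *)
  rewrite /a (@mean_resample _ _ _ _ _ _ _ X hindep (fun y => `|G j.+1 y - mu| `^ k) j)//.
  rewrite -meanZ; last exact: bounded_measurable_comp (measurable_joint X) (bGmu j).
  rewrite -[X in _ + X](mean_cst P) -meanD; last 2 first.
  - apply: bounded_measurableM; first exact: bounded_measurable_cst.
    exact: bounded_measurable_comp (measurable_joint X) (bGmu j).
  - exact: bounded_measurable_cst.
  apply: le_mean => [||w].
  - exact: (bounded_measurable_mean P P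
     (bounded_measurable_comp (measurable_update_joint X j) (bGmu j.+1))).
  - apply: bounded_measurableD; last exact: bounded_measurable_cst.
    apply: bounded_measurableM; first exact: bounded_measurable_cst.
    exact: bounded_measurable_comp (measurable_joint X) (bGmu j).
  set y := joint X w; set s := G j y - mu.
  pose g w' := G j.+1 (update y j (X j w')) - G j y.
  have bg1 : bounded_measurable (fun w' => G j.+1 (update y j (X j w'))).
    exact: bounded_measurable_comp (measurable_update_RV X y j) (bG j.+1).
  have bg : bounded_measurable g.
    by apply: bounded_measurableB => //; exact: bounded_measurable_cst.
  have g0 : \int[P]_w' g w' = 0.
    rewrite meanB//; last exact: bounded_measurable_cst.
    by rewrite mean_cst /G partial_mean_step// subrr.
  have g2 : \int[P]_w' (`|g w'| `^ 2) <= c2 * v j.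
    by apply: (increment_moment_le hindep bF (Fj := F_ j)) => //; lra.
  have gk : \int[P]_w' (`|g w'| `^ k) <= ck * m j.
    by apply: (increment_moment_le hindep bF (Fj := F_ j)).
  have := conditional_step s hk bg g0 g2 gk.
  rewrite (_ : (fun w' => `|s + g w'| `^ k) =
    fun w' => `|G j.+1 (update y j (X j w')) - mu| `^ k); last first.
    by apply/funext => w'; congr (`| _ | `^ _); rewrite /s /g; ring.
  move=> /le_trans; apply; rewrite -/C0 -thetaV.
  have Y := young_powR_sqr s hk V0 eta_gt0; rewrite -/K in Y.
  have : C0 * theta j * (V * `|s| `^ (k - 2)) <=
         C0 * theta j * (eta * `|s| `^ k + K * V `^ (k / 2)).
    by rewrite ler_wpM2l// mulr_ge0// ltW.
  have -> : C0 * theta j * (eta * `|s| `^ k + K * V `^ (k / 2)) =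
     theta j / 2 * `|s| `^ k + theta j * (C0 * K * V `^ (k / 2)).
    by rewrite /eta; field; lra.
  by rewrite /b; lra.
apply: le_trans (linear_recurrence_le a0 t0 b0 theta1 step) _.
rewrite -[leRHS]mulrA; apply: ler_wpM2l => //.
rewrite /b big_split/= -mulr_suml -mulr_sumr -mulr_sumr.
have -> : V `^ (k / 2) = c2 `^ (k / 2) * (\sum_j v j) `^ (k / 2).
  by rewrite /V -mulr_sumr powRM// sumr_ge0.
set A := (\sum_j v j) `^ _; set B := \sum_j m j.
have A0 : 0 <= A by exact: powR_ge0.
have B0 : 0 <= B by rewrite sumr_ge0.
have c2k : 0 <= c2 `^ (k / 2) by exact: powR_ge0.
have h1 : (\sum_j theta j) * (C0 * K * (c2 `^ (k / 2) * A)) <=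
   C0 * K * c2 `^ (k / 2) * A.
  rewrite -[leRHS]mul1r (mulrA (C0 * K)); apply: ler_wpM2r => //.
  by rewrite !mulr_ge0 ?(ltW C0_gt0).
have h2 : 0 <= C0 * K * c2 `^ (k / 2) * B by rewrite !mulr_ge0// ltW.
have h3 : 0 <= C0 * ck * A by rewrite !mulr_ge0// ltW.
lra.
Qed.

(** * Rank one updates and the weighted covariance matrix *)

Section DotProduct.
Variables (R : realType) (p : nat).
Implicit Types (u v w x a : 'cV[R]_p) (M N : 'M[R]_p) (c s t : R).

Lemma dotvE u v : dotv u v = \sum_j u j 0 * v j 0.
Proof. by rewrite /dotv mxE; apply: eq_bigr => j _; rewrite mxE. Qed.

Lemma dotvC u v : dotv u v = dotv v u.
Proof. by rewrite !dotvE; apply: eq_bigr => j _; rewrite mulrC. Qed.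

Lemma dotvDr u v w : dotv u (v + w) = dotv u v + dotv u w.
Proof. by rewrite /dotv mulmxDr mxE. Qed.

Lemma dotvBr u v w : dotv u (v - w) = dotv u v - dotv u w.
Proof. by rewrite /dotv mulmxBr !mxE. Qed.

Lemma dotvZr u c v : dotv u (c *: v) = c * dotv u v.
Proof. by rewrite /dotv -scalemxAr mxE. Qed.

Lemma dotv_ge0 v : 0 <= dotv v v.
Proof. by rewrite dotvE sumr_ge0// => j _; rewrite -expr2 sqr_ge0. Qed.

Lemma dotv_eq0 v : dotv v v = 0 -> v = 0.
Proof.
rewrite dotvE => v0; apply/colP => j; rewrite mxE; apply/eqP.
rewrite -sqrf_eq0 expr2; apply/eqP.
exact: (psumr_eq0P (fun j _ => sqr_ge0 (v j 0)) v0).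
Qed.

Lemma enorm_sqr v : enorm v ^+ 2 = dotv v v.
Proof.
rewrite /enorm sqr_sqrtr; last by rewrite sumr_ge0// => j _; rewrite sqr_ge0.
by rewrite dotvE; apply: eq_bigr => j _; rewrite expr2.
Qed.

Lemma enorm_ge0 v : 0 <= enorm v.
Proof. exact: sqrtr_ge0. Qed.

Lemma enormZ c v : enorm (c *: v) = `|c| * enorm v.
Proof.
apply/eqP; rewrite -(@eqrXn2 _ 2)// ?mulr_ge0 ?enorm_ge0//.
by rewrite exprMn !enorm_sqr dotvZr dotvC dotvZr real_normK ?num_real// mulrA.
Qed.

Lemma qform_dotv M v : qform M v = dotv v (M *m v).
Proof. by rewrite /qform /dotv mulmxA. Qed.

Lemma dotv_mulmx_sym M u v : M^T = M -> dotv u (M *m v) = dotv (M *m u) v.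
Proof. by move=> sM; rewrite /dotv trmx_mul sM mulmxA. Qed.

Lemma mulmx_outer a u : (a *m a^T) *m u = dotv a u *: a.
Proof.
rewrite -mulmxA; apply/colP => j; rewrite !mxE big_ord1 mulrC.
by rewrite -[(a^T *m u) 0 0]/(dotv a u).
Qed.

End DotProduct.

Section Coercive.
Variables (R : realType) (p : nat).
Implicit Types (u v x a : 'cV[R]_p) (M : 'M[R]_p) (s t : R).

(** Symmetric and at least [t] times the identity in the Loewner order. *)
Definition coercive t M : Prop :=
  M^T = M /\ forall v, t * dotv v v <= qform M v.

Variable t : R.
Hypothesis ht : 0 < t.

Lemma coercive_unitmx M : coercive t M -> M \in unitmx.
Proof.
move=> [sM cM]; rewrite -row_free_unit; apply/inj_row_free => v vM.
have := cM v^T; rewrite /qform trmxK vM mul0mx mxE => h.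
have : dotv v^T v^T = 0.
  by apply/eqP; rewrite eq_le dotv_ge0 andbT -(pmulr_rle0 _ ht).
by move/dotv_eq0 => /(congr1 trmx); rewrite trmxK trmx0.
Qed.

Lemma coercive_mulVmx M x : coercive t M -> M *m (invmx M *m x) = x.
Proof. by move=> cM; rewrite mulmxA mulmxV ?mul1mx// coercive_unitmx. Qed.

(** With [u = M^-1 x] the form is [x . u], and [t |u|^2 <= x . u] by
    coercivity.  Together with [0 <= |x - t u|^2] this gives
    [x . u <= 1 / t]. *)
Lemma coercive_invmx_bounds M x : coercive t M -> enorm x = 1 ->
  [/\ 0 <= qform (invmx M) x, qform (invmx M) x <= t^-1 &
      enorm (invmx M *m x) <= t^-1].
Proof.
move=> cM x1; rewrite qform_dotv; set u := invmx M *m x.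
have Mu : M *m u = x by exact: coercive_mulVmx.
have h : t * dotv u u <= dotv x u.
  by case: (cM) => _ /(_ u); rewrite qform_dotv Mu dotvC.
have u0 := dotv_ge0 u.
have xx : dotv x x = 1 by rewrite -enorm_sqr x1 expr1n.
have := dotv_ge0 (x - t *: u).
rewrite !(dotvBr, dotvZr) (dotvC (_ - _)) (dotvC (x - _) u).
rewrite !(dotvBr, dotvZr) xx (dotvC u x) => h2.
have tV : t * t^-1 = 1 by rewrite divff// gt_eqF.
have tV0 : 0 < t^-1 by rewrite invr_gt0.
have h3 : t * dotv x u <= 1 by nra.
have h4 : dotv x u <= t^-1 by rewrite -[leRHS]mul1r ler_pdivlMr// mulrC.
split => //; first by rewrite (le_trans _ h)// mulr_ge0// ltW.
rewrite -(@ler_pXn2r _ 2)// ?nnegrE ?enorm_ge0 ?(ltW tV0)// enorm_sqr.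
rewrite -(ler_pM2l ht) (le_trans h)// (le_trans h4)//.
by rewrite expr2 mulrA tV mul1r.
Qed.

(** Write [w = M0^-1 x] and [u = M^-1 x].  Symmetry turns the difference of the
    two forms into [s (a . u) (a . w)], and the coercivity of [M0] at [w - u]
    gives [s (a . u) (a . w - a . u) >= 0]; both bounds follow. *)
Lemma rank_one_update_bounds M0 M s a x : coercive t M0 -> coercive t M ->
  0 <= s -> M = M0 + s *: (a *m a^T) ->
  0 <= qform (invmx M0) x - qform (invmx M) x <=
    s * dotv a (invmx M0 *m x) ^+ 2.
Proof.
move=> cM0 cM s0 eM; rewrite !qform_dotv.
set w := invmx M0 *m x; set u := invmx M *m x.
have M0w : M0 *m w = x by exact: coercive_mulVmx.
have Mu : M *m u = x by exact: coercive_mulVmx.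
have {}Mu : M0 *m u + (s * dotv a u) *: a = x.
  by rewrite -[RHS]Mu eM mulmxDl -scalemxAl mulmx_outer scalerA.
have [sM0 pM0] := cM0.
have -> : dotv x w - dotv x u = s * dotv a u * dotv a w.
  rewrite -{1}Mu -[X in _ - dotv X _]M0w -dotv_mulmx_sym// (dotvC w) dotvC.
  by rewrite dotvDr dotvZr (dotvC w (_ *m _)) (dotvC w a); ring.
have h : 0 <= s * dotv a u * (dotv a w - dotv a u).
  have <- : qform M0 (w - u) = s * dotv a u * (dotv a w - dotv a u).
    have e : M0 *m (w - u) = (s * dotv a u) *: a.
      by rewrite mulmxBr M0w -[X in X - _]Mu addrAC subrr add0r.
    by rewrite qform_dotv e dotvZr (dotvC (w - u)) dotvBr.
  by apply: le_trans (pM0 _); rewrite mulr_ge0 ?dotv_ge0// ltW.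
have h1 : 0 <= s * dotv a u ^+ 2 by rewrite mulr_ge0 ?sqr_ge0.
have h2 : 0 <= s * (dotv a w - dotv a u) ^+ 2 by rewrite mulr_ge0 ?sqr_ge0.
by apply/andP; split; lra.
Qed.

End Coercive.

Section RegularizedCovariance.
Variables (R : realType) (p n : nat) (A : 'M[R]_p) (t : R).
Hypotheses (hA : posdefmx A) (hAt : loewner_ge A t%:M).
Implicit Types (r : 'I_n -> R) (X : 'I_n -> 'cV[R]_p).

Lemma weighted_cov_coercive r X : coercive t (weighted_cov r X + A).
Proof.
split.
  rewrite linearD/= hA.1; congr (_ + _); rewrite /weighted_cov linearZ/= linear_sum/=.
  congr (_ *: _); apply: eq_bigr => i _.
  by rewrite linearZ/= trmx_mul trmxK.
move=> v; rewrite qform_dotv mulmxDl dotvDr.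
have h : t * dotv v v <= dotv v (A *m v).
  have := hAt.2 v; rewrite qform_dotv mulmxBl dotvBr mul_scalar_mx dotvZr; lra.
apply: le_trans h _; rewrite lerDr /weighted_cov -scalemxAl dotvZr mulr_ge0//.
rewrite mulmx_suml /dotv mulmx_sumr summxE sumr_ge0// => i _.
rewrite -[X in 0 <= X]/(dotv v _) -scalemxAl mulmx_outer !dotvZr dotvC.
by rewrite mulr_ge0 ?sqr_ge0// -expr2 sqr_ge0.
Qed.

Lemma weighted_cov_leave_one_out r X j :
  weighted_cov r X = weighted_cov (fun i => if i == j then 0 else r i) X +
    (r j ^+ 2 / n%:R) *: (X j *m (X j)^T).
Proof.
rewrite /weighted_cov (bigD1 j)//= [in RHS](bigD1 j)//= eqxx expr0n/= scale0r add0r.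
rewrite scalerDr addrC; congr (_ + _); last by rewrite scalerA mulrC.
by congr (_ *: _); apply: eq_bigr => i /negbTE ->.
Qed.

End RegularizedCovariance.

Section Measurability.
Context d (S : measurableType d) (R : realType).

(** The identity [a^-1 = a * (a^2)^-1] also holds at [a = 0], and the inverse of
    a nonnegative number is a real power, which is measurable. *)
Lemma measurable_invr (f : S -> R) : measurable_fun [set: S] f ->
  measurable_fun [set: S] (fun s => (f s)^-1).
Proof.
move=> mf.
rewrite (_ : (fun s => _) = fun s => f s * (f s ^+ 2) `^ (-1)).
  apply: measurable_realfun.measurable_funM => //.
  apply: (measurableT_comp (measurable_realfun.measurable_powR (-1))).
  exact: measurable_realfun.measurable_funX.
apply/funext => s; rewrite powR_inv1 ?sqr_ge0//.
have [->|f0] := eqVneq (f s) 0; first by rewrite mul0r invr0.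
by field.
Qed.

Lemma measurable_det p (M : S -> 'M[R]_p) :
  (forall i j, measurable_fun [set: S] (fun s => M s i j)) ->
  measurable_fun [set: S] (fun s => \det (M s)).
Proof.
move=> mM; apply: measurable_sum => sigma.
apply: measurable_realfun.measurable_funM; first exact: measurable_cst.
by apply: measurable_prod => i _; exact: mM.
Qed.

(** By Cramer's rule the form is a rational function of the entries. *)
Lemma measurable_qform_invmx p (M : S -> 'M[R]_p) x :
  (forall s, M s \in unitmx) ->
  (forall i j, measurable_fun [set: S] (fun s => M s i j)) ->
  measurable_fun [set: S] (fun s => qform (invmx (M s)) x).
Proof.
move=> uM mM.
rewrite (_ : (fun s => _) = fun s => \sum_i \sum_j
   x i 0 * (((\det (M s))^-1 * cofactor (M s) j i) * x j 0)); last first.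
  apply/funext => s; rewrite qform_dotv dotvE; apply: eq_bigr => i _.
  rewrite mxE mulr_sumr; apply: eq_bigr => j _.
  by rewrite /invmx uM !mxE.
apply: measurable_sum => i; apply: measurable_sum => j.
apply: measurable_realfun.measurable_funM; first exact: measurable_cst.
apply: measurable_realfun.measurable_funM; last exact: measurable_cst.
apply: measurable_realfun.measurable_funM.
  by apply: measurable_invr; exact: measurable_det.
apply: measurable_realfun.measurable_funM; first exact: measurable_cst.
apply: measurable_det => a b.
rewrite (_ : (fun s => _) = fun s => M s (lift j a) (lift i b)) ?mM//.
by apply/funext => s; rewrite !mxE.
Qed.

End Measurability.

(** * Leave-one-out moments of the quadratic form *)

Section QuadraticForm.
Variables (R : realType) (p n : nat) (A : 'M[R]_p) (t : R) (x : 'cV[R]_p).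
Hypotheses (ht : 0 < t) (hA : posdefmx A) (hAt : loewner_ge A t%:M).
Hypothesis hx : enorm x = 1.
Implicit Types (r : 'I_n -> R) (y : n.-tuple (p.-tuple R)).

Definition covariance_mx r y : 'M[R]_p :=
  weighted_cov r (fun i => vec (tnth y i)) + A.

Definition resolvent_form r y : R := qform (invmx (covariance_mx r y)) x.

Definition drop_weight (j : 'I_n) r : 'I_n -> R :=
  fun i => if i == j then 0 else r i.

Let coercive_cov r y : coercive t (covariance_mx r y).
Proof. exact: weighted_cov_coercive. Qed.

Lemma bounded_measurable_resolvent_form r : bounded_measurable (resolvent_form r).
Proof.
split; last first.
  exists t^-1 => y.
  have [h0 h1 _] := coercive_invmx_bounds ht (coercive_cov r y) hx.
  by rewrite ger0_norm.
apply: measurable_qform_invmx => [y|a b].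
  exact: coercive_unitmx (coercive_cov r y).
rewrite (_ : (fun y => _) = fun y => n%:R^-1 *
  (\sum_i r i ^+ 2 * (tnth (tnth y i) a * tnth (tnth y i) b)) + A a b); last first.
  apply/funext => y; rewrite !mxE summxE; congr (_ * _ + _).
  by apply: eq_bigr => i _; rewrite !mxE big_ord1 !mxE.
have mt i a' : measurable_fun [set: n.-tuple (p.-tuple R)] (fun y => tnth (tnth y i) a').
  exact: measurableT_comp (measurable_tnth a') (measurable_tnth i).
apply: measurable_realfun.measurable_funD; last exact: measurable_cst.
apply: measurable_realfun.measurable_funM; first exact: measurable_cst.
apply: measurable_sum => i.
apply: measurable_realfun.measurable_funM; first exact: measurable_cst.
by apply: measurable_realfun.measurable_funM; exact: mt.
Qed.

Lemma covariance_mx_drop_update r j y z :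
  covariance_mx (drop_weight j r) (update y j z) =
  covariance_mx (drop_weight j r) y.
Proof.
rewrite /covariance_mx /weighted_cov; congr (_ + _); congr (_ *: _).
apply: eq_bigr => i _; rewrite /drop_weight tnth_mktuple.
by case: eqVneq => // _; rewrite expr0n/= !scale0r.
Qed.

Lemma resolvent_form_drop_update r j y z :
  resolvent_form (drop_weight j r) (update y j z) =
  resolvent_form (drop_weight j r) y.
Proof. by rewrite /resolvent_form covariance_mx_drop_update. Qed.

Lemma resolvent_form_drop_bounds r j y
    (b := dotv (vec (tnth y j)) (invmx (covariance_mx (drop_weight j r) y) *m x)) :
  `|resolvent_form r y - resolvent_form (drop_weight j r) y| <=
    Num.min (r j ^+ 2 / n%:R * `|b| ^+ 2) t^-1.
Proof.
have s0 : 0 <= r j ^+ 2 / n%:R by rewrite divr_ge0 ?sqr_ge0.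
have eM : covariance_mx r y = covariance_mx (drop_weight j r) y +
    (r j ^+ 2 / n%:R) *: (vec (tnth y j) *m (vec (tnth y j))^T).
  by rewrite /covariance_mx (weighted_cov_leave_one_out r _ j) addrAC.
have := rank_one_update_bounds ht x (coercive_cov (drop_weight j r) y)
  (coercive_cov r y) s0 eM.
rewrite -/(resolvent_form r y) -/(resolvent_form (drop_weight j r) y) -/b => /andP[D0 D1].
have [f0 _ _] := coercive_invmx_bounds ht (coercive_cov r y) hx.
have [_ f1 _] := coercive_invmx_bounds ht (coercive_cov (drop_weight j r) y) hx.
rewrite distrC ger0_norm// real_normK ?num_real// le_min D1/=.
by rewrite (le_trans _ f1)// gerBl.
Qed.

Context d (T : measurableType d) (P : probability T R).

(** The two terms of the minimum come from the two bounds on the difference.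
    For the first one the vector [u] below is fixed, as it ignores coordinate
    [j], and the moment hypothesis applies to its direction [v]. *)
Lemma leave_one_out_moment_le r (X : 'I_n -> {RV P >-> p.-tuple R}) j y (q beta : R) :
  0 < q ->
  (forall v : 'cV[R]_p, enorm v = 1 ->
    ('E_P[fun w => (`|dotv (vec (X j w)) v| `^ (2 * q))%R] <= beta%:E)%E) ->
  \int[P]_w (`|resolvent_form r (update y j (X j w)) -
               resolvent_form (drop_weight j r) y| `^ q) <=
  (t `^ (2 * q))^-1 *
    Num.min (`|r j| `^ (2 * q) / n%:R `^ q * beta) (t `^ q).
Proof.
move=> q0 hv.
pose Y w := update y j (X j w); pose u := invmx (covariance_mx (drop_weight j r) y) *m x.
pose D w := resolvent_form r (Y w) - resolvent_form (drop_weight j r) y.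
have DE w : D w = resolvent_form r (Y w) - resolvent_form (drop_weight j r) (Y w).
  by rewrite /D resolvent_form_drop_update.
have bD : bounded_measurable D.
  apply: bounded_measurableB; last exact: bounded_measurable_cst.
  exact: bounded_measurable_comp (measurable_update_RV X y j)
    (bounded_measurable_resolvent_form r).
have bDq := bounded_measurable_powR_norm (ltW q0) bD.
have YE w : tnth (Y w) j = X j w by rewrite tnth_mktuple eqxx.
have uE w : invmx (covariance_mx (drop_weight j r) (Y w)) *m x = u.
  by rewrite covariance_mx_drop_update.
have Db w : `|D w| <= Num.min (r j ^+ 2 / n%:R * `|dotv (vec (X j w)) u| ^+ 2) t^-1.
  by have := resolvent_form_drop_bounds r j (Y w); rewrite YE uE -DE.
have tq0 : 0 < t `^ (2 * q) by exact: powR_gt0.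
have tV a : (t `^ a)^-1 = t^-1 `^ a.
  by rewrite -powRN -(powR_inv1 (ltW ht)) -powRrM mulN1r.
have tVt : (t `^ (2 * q))^-1 * t `^ q = t^-1 `^ q.
  rewrite mulrC -powRN -powRD; last by rewrite (gt_eqF ht) implybT.
  by rewrite -tV -powRN; congr (_ `^ _); ring.
rewrite minr_pMr ?invr_ge0 ?(ltW tq0)// le_min; apply/andP; split; last first.
  rewrite tVt -[leRHS](mean_cst P); apply: le_mean => //.
    exact: bounded_measurable_cst.
  move=> w; apply: ge0_ler_powR; rewrite ?nnegrE ?invr_ge0 ?(ltW q0) ?(ltW ht)//.
  by have := Db w; rewrite le_min => /andP[].
have [_ _ u1] := coercive_invmx_bounds ht (coercive_cov (drop_weight j r) y) hx.
rewrite -/u in u1.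
have u0 : 0 < enorm u.
  rewrite lt_neqAle enorm_ge0 andbT eq_sym; apply/eqP => eu.
  have uz : u = 0 by apply: dotv_eq0; rewrite -enorm_sqr eu expr0n.
  have := coercive_mulVmx ht x (coercive_cov (drop_weight j r) y).
  rewrite -/u uz mulmx0 => x0; have := enorm_sqr x.
  rewrite hx -x0 dotvE big1 ?expr1n => [/eqP|i _]; first by rewrite oner_eq0.
  by rewrite mxE mul0r.
pose v := (enorm u)^-1 *: u.
have v1 : enorm v = 1.
  by rewrite enormZ ger0_norm ?invr_ge0 ?enorm_ge0// mulVf// gt_eqF.
have uv : u = enorm u *: v by rewrite scalerA divff ?scale1r// gt_eqF.
have hE := hv v v1; rewrite unlock in hE.
pose c := (r j ^+ 2 / n%:R) `^ q * (t `^ (2 * q))^-1.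
have c0 : 0 <= c by rewrite mulr_ge0 ?powR_ge0// invr_ge0 ltW.
have s0 : 0 <= r j ^+ 2 / n%:R by rewrite divr_ge0 ?sqr_ge0.
have cE : (t `^ (2 * q))^-1 * (`|r j| `^ (2 * q) / n%:R `^ q * beta) = c * beta.
  rewrite /c powRM ?sqr_ge0 ?invr_ge0// -(real_normK (num_real (r j))).
  rewrite -powR_mulrn// -powRrM -(@powR_inv1 _ n%:R)// -powRrM mulN1r powRN; ring.
rewrite cE.
pose g w := `|dotv (vec (X j w)) v| `^ (2 * q).
have mg : measurable_fun [set: T] g.
  apply: (measurableT_comp (measurable_realfun.measurable_powR _)).
  apply: (measurableT_comp (@measurable_realfun.normr_measurable _ _)).
  rewrite (_ : (fun w => _) = fun w => \sum_i tnth (X j w) i * v i 0).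
    apply: measurable_sum => i.
    apply: measurable_realfun.measurable_funM; last exact: measurable_cst.
    exact: measurableT_comp (measurable_tnth i) _.
  by apply/funext => w; rewrite dotvE; apply: eq_bigr => i _; rewrite !mxE.
have Dg w : `|D w| `^ q <= c * g w.
  have := Db w; rewrite le_min => /andP[Dw _].
  apply: (@le_trans _ _ ((r j ^+ 2 / n%:R * `|dotv (vec (X j w)) u| ^+ 2) `^ q)).
    by apply: ge0_ler_powR; rewrite ?nnegrE ?(ltW q0)// mulr_ge0 ?sqr_ge0.
  rewrite powRM ?sqr_ge0// /c -mulrA ler_wpM2l ?powR_ge0//.
  rewrite -powR_mulrn// -powRrM uv dotvZr normrM (ger0_norm (enorm_ge0 _)).
  rewrite powRM ?enorm_ge0// ler_wpM2r ?powR_ge0//.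
  rewrite tV; apply: ge0_ler_powR;
    by rewrite ?nnegrE ?enorm_ge0 ?invr_ge0 ?(ltW ht)//; lra.
clearbody c; rewrite -lee_fin EFin_Rintegral//.
apply: (@le_trans _ _ (\int[P]_w (c * g w)%:E)%E).
  apply: ge0_le_integral => //.
  - by apply/measurable_realfun.measurable_EFinP; case: bDq.
  - apply/measurable_realfun.measurable_EFinP.
    by apply: measurable_realfun.measurable_funM => //; exact: measurable_cst.
  - by move=> w _; rewrite lee_fin Dg.
under eq_integral do rewrite EFinM.
rewrite ge0_integralZl_EFin//.
- by rewrite EFinM; apply: lee_wpmul2l; rewrite ?lee_fin.
- by move=> w _; rewrite lee_fin powR_ge0.
- exact/measurable_realfun.measurable_EFinP.
Qed.

End QuadraticForm.

(** * The moment bound *)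

Theorem theorem3p1 (R : realType) (k : R) (hk : 2 <= k) :
  exists c : R,
  forall (d : measure_display) (T : measurableType d) (P : probability T R)
    (n p : nat) (hn : (0 < n)%N)
    (X : 'I_n -> {RV P >-> p.-tuple R})
    (bL : R -> probability (p.-tuple R) R -> \bar R)
    (r : 'I_n -> R) (A : 'M[R]_p) (t : R) (x : 'cV[R]_p)
    (hindep : mutually_independent X)
    (hmean : forall i (j : 'I_p), ('E_P[fun w => tnth (X i w) j] = 0)%E)
    (hmoment : forall i (q : R), 0 < q -> forall v : 'cV[R]_p, enorm v = 1 ->
      ('E_P[fun w => (`|dotv (vec (X i w)) v| `^ q)%R]
        <= bL q (distribution P (X i)))%E)
    (hfin4 : forall i, bL 4 (distribution P (X i)) \is a fin_num)
    (hfin2k : forall i, bL (2 * k) (distribution P (X i)) \is a fin_num)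
    (ht : 0 < t) (hA : posdefmx A) (hAt : loewner_ge A t%:M)
    (hx : enorm x = 1),
  let M w := weighted_cov r (fun i => vec (X i w)) + A in
  let f w := qform (invmx (M w)) x in
  ('E_P[fun w => (`|f w - fine 'E_P[f]%E| `^ k)%R]
    <= (c / t `^ (2 * k))%:E *
       ((\sum_(i < n) mine ((r i ^+ 4 / n%:R ^+ 2)%:E
                              * bL 4%R (distribution P (X i)))
                           (t ^+ 2)%:E) `^ (k / 2)%R
        + \sum_(i < n) mine ((`|r i| `^ (2 * k) / n%:R `^ k)%:E
                              * bL (2 * k)%R (distribution P (X i)))
                            (t `^ k)%:E))%E.
Proof.
have [C C0 H] := moment_le_leave_one_out hk.
exists C => d T P n p hn X bL r A t x hindep hmean hmoment hfin4 hfin2k ht hA hAt hx.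
cbv zeta.
set f := fun w : T => qform (invmx (weighted_cov r (fun i => vec (X i w)) + A)) x.
pose F := resolvent_form A x r.
pose F_ j := resolvent_form A x (drop_weight j r).
have fF : f = fun w => F (joint X w).
  apply/funext => w; rewrite /f /F /resolvent_form /covariance_mx.
  congr (qform (invmx _) x); congr (_ + A).
  congr (weighted_cov r _); apply/funext => i.
  by rewrite tnth_mktuple.
have bF : bounded_measurable F := bounded_measurable_resolvent_form ht hA hAt hx r.
have k0 : 0 < k by lra.
have two0 : 0 < 2 :> R by [].
have mom_ge0 i (q : R) : 0 < q -> (0 <= bL q (distribution P (X i)))%E.
  move=> q0; apply: le_trans (hmoment i q q0 x hx).
  by rewrite unlock; apply: integral_ge0 => w _; rewrite lee_fin powR_ge0.
pose beta q i := fine (bL q (distribution P (X i))).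
pose W q i := Num.min (`|r i| `^ (2 * q) / n%:R `^ q * beta (2 * q) i) (t `^ q).
have W0 (q : R) i : 0 < q -> 0 <= W q i.
  move=> q0; rewrite le_min powR_ge0 andbT; apply: mulr_ge0.
    by rewrite divr_ge0 ?powR_ge0.
  by apply: fine_ge0; apply: mom_ge0; rewrite mulr_gt0.
have WE q i : bL (2 * q) (distribution P (X i)) \is a fin_num ->
    mine ((`|r i| `^ (2 * q) / n%:R `^ q)%:E * bL (2 * q)%R (distribution P (X i)))%E
      (t `^ q)%:E = (W q i)%:E.
  by move=> qfin; rewrite /W /beta EFin_min [in RHS]EFinM fineK.
(* The order [4] moment is the case [q = 2] of the bound with exponent [2 q]. *)
have h22 : 2 * 2 = 4 :> R by ring.
have fin22 i : bL (2 * 2) (distribution P (X i)) \is a fin_num by rewrite h22.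
have WE2 i : mine ((r i ^+ 4 / n%:R ^+ 2)%:E * bL 4%R (distribution P (X i)))%E
    (t ^+ 2)%:E = (W 2 i)%:E.
  rewrite -WE// h22 (@powR_mulrn _ _ 4)// !(@powR_mulrn _ _ 2)//; last exact: ltW.
  by congr (mine ((_ / _)%:E * _)%E _); rewrite -normrX ger0_norm// exprn_even_ge0.
have hW q i y : 0 < q -> bL (2 * q) (distribution P (X i)) \is a fin_num ->
    \int[P]_w (`|F (update y i (X i w)) - F_ i y| `^ q) <= (t `^ (2 * q))^-1 * W q i.
  move=> q0 qfin; apply: leave_one_out_moment_le => // v v1.
  by rewrite fineK//; apply: hmoment => //; rewrite mulr_gt0.
have tV q : 0 <= (t `^ q)^-1 by rewrite invr_ge0 powR_ge0.
have HM := H d T P _ _ n X F F_ (fun i => (t `^ (2 * 2))^-1 * W 2 i)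
  (fun i => (t `^ (2 * k))^-1 * W k i) hindep bF
  (fun j => bounded_measurable_resolvent_form ht hA hAt hx (drop_weight j r))
  (resolvent_form_drop_update A x r)
  (fun i => mulr_ge0 (tV _) (W0 _ _ two0))
  (fun i => mulr_ge0 (tV _) (W0 _ _ k0))
  (fun i y => hW 2 i y two0 (fin22 i))
  (fun i y => hW k i y k0 (hfin2k i)).
under [X in (X `^ _)%E]eq_bigr do rewrite WE2.
under [X in (_ + X)%E]eq_bigr do rewrite WE//.
rewrite !sumEFin poweR_EFin -EFinD -EFinM.
rewrite -!mulr_sumr powRM// in HM; last by rewrite sumr_ge0// => i _; exact: W0.
have tk : (t `^ (2 * 2))^-1 `^ (k / 2) = (t `^ (2 * k))^-1.
  rewrite -!powRN -powRrM; congr (_ `^ _); by field.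
rewrite tk -mulrDr mulrA in HM.
rewrite unlock -[fine _]/(\int[P]_w f w) fF -EFin_Rintegral ?lee_fin//.
apply: bounded_measurable_powR_norm; first exact: ltW.
apply: bounded_measurableB; last exact: bounded_measurable_cst.
exact: bounded_measurable_comp (measurable_joint X) bF.
Qed.
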